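(* Let $\mathbb Z_4=\mathbb Z/4\mathbb Z$ and let $$S=\left\{\begin{pmatrix}a&b\\c&d\end{pmatrix}\in \operatorname{M}_2(\mathbb Z_4): b\in 2\mathbb Z_4\right\},$$ a subring of the $2\times2$ matrix ring $\operatorname{M}_2(\mathbb Z_4)$. Then the null ideal $\mathcal N(S)$ is not a two-sided ideal of $S[x]$.
   Context: All rings are associative with identity. For a finite ring $R$, $R[x]$ is the polynomial ring in a central indeterminate $x$ (that is, $x$ commutes with the coefficients, which need not commute with each other). For $F(x)=\sum_i c_i x^i\in R[x]$ with $c_i\in R$, the right value of $F$ at $a\in R$ is $F(a)=\sum_i c_i a^i$ (coefficients written on the left of the powers). The null ideal of $R$ is $\mathcal N(R)=\{F\in R[x]: F(a)=0\text{ for every }a\in R\}$; it is always a left ideal of $R[x]$, but need not be a right ideal. The ring $S$ has order $128$ and characteristic $4$. *)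

(* Defs.v *)
From HB Require Import structures.
From mathcomp Require Import all_boot all_order all_algebra.

Set Implicit Arguments.
Unset Strict Implicit.
Unset Printing Implicit Defensive.

Import GRing.Theory.
Local Open Scope ring_scope.

(* In {poly R} the variable 'X is central even when R is not commutative, and  *)
(* F.[a] = \sum_i F`_i * a ^+ i keeps the coefficients on the left.            *)
Definition null_ideal (R : finNzRingType) : {pred {poly R}} :=
  [pred F : {poly R} | [forall a : R, F.[a] == 0]].
Arguments null_ideal : clear implicits.

Definition left_ideal (A : pzRingType) (I : {pred A}) : Prop :=
  zmod_closed I /\ (forall r x : A, x \in I -> r * x \in I).

Definition right_ideal (A : pzRingType) (I : {pred A}) : Prop :=
  zmod_closed I /\ (forall r x : A, x \in I -> x * r \in I).

Definition two_sided_ideal (A : pzRingType) (I : {pred A}) : Prop :=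
  left_ideal I /\ right_ideal I.

Definition S_pred : {pred 'M['Z_4]_2} :=
  [pred A : 'M['Z_4]_2 | [exists z : 'Z_4, A 0 1 == 2 * z]].

Lemma S_predP (A : 'M['Z_4]_2) :
  reflect (exists z : 'Z_4, A 0 1 = 2 * z) (A \in S_pred).
Proof. exact: 'exists_eqP. Qed.

Lemma S_subring_closed : subring_closed S_pred.
Proof.
split=> [|A B /S_predP[y Ay] /S_predP[z Bz]|A B /S_predP[y Ay] /S_predP[z Bz]];
  apply/S_predP.
- by exists 0; rewrite mxE mulr0.
- by exists (y - z); rewrite !mxE Ay Bz mulrBr.
- exists (A 0 0 * z + y * B 1 1).
  have -> : (A * B) 0 1 = A 0 0 * B 0 1 + A 0 1 * B 1 1.
    have lift01 : lift ord0 ord0 = 1 :> 'I_2 by apply: val_inj.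
    by rewrite mxE big_ord_recl big_ord1 lift01.
  by rewrite Ay Bz mulrDr mulrCA !mulrA.
Qed.

HB.instance Definition _ :=
  GRing.isSubringClosed.Build 'M['Z_4]_2 S_pred S_subring_closed.

Record ringS := RingS { S_val :> 'M['Z_4]_2; S_valP : S_val \in S_pred }.

HB.instance Definition _ := [isSub for S_val].
HB.instance Definition _ := [Finite of ringS by <:].
HB.instance Definition _ := [SubChoice_isSubNzRing of ringS by <:].

(* Main.v *)
(** Right multiplication by a unit [r] preserves the null ideal, because
    [(F r)(a) = F(r a r^-1) r], so one tests the idempotent [e11] instead.
    Put [p = x^2 (x + 1)^2] and [q = x^2 (x^2 - 1) (x^2 + x + 2)].  The first row
    of [p(A)] plus the second row of [q(A)] vanishes for every [A] in [S], so
    [F = e21 p + e22 q] lies in the null ideal, whereas [F e11 = e21 p] takes the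
    value [2 e21] at [A = ((0, 2), (1, 0))], for which [A^2 = 2]. *)

Require Import Defs.
From mathcomp Require Import all_boot all_order all_algebra.
Local Open Scope ring_scope.

Set Implicit Arguments.
Unset Strict Implicit.

Import GRing.Theory.

Lemma Z4_all (P : pred 'Z_4) : all P [:: 0; 1; 2; 3] -> forall x, P x.
Proof.
move=> /allP allP x; apply: allP.
by case: x => [[|[|[|[|//]]]] ?].
Qed.

Lemma Poly_mulC (R : nzRingType) (s : seq R) (c : R) :
  Poly s * c%:P = Poly [seq u * c | u <- s].
Proof.
elim: s => [|u s IHs] /=; first by rewrite mul0r.
by rewrite !cons_poly_def mulrDl -IHs -mulrA -commr_polyX mulrA polyCM.
Qed.

Lemma mulmx2E (R : pzSemiRingType) (A B : 'M[R]_2) i j :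
  (A *m B) i j = A i 0 * B 0 j + A i 1 * B 1 j.
Proof.
rewrite mxE big_ord_recl big_ord1.
by congr (_ + A i _ * B _ j); apply: val_inj.
Qed.

Definition mx2 (R : Type) (a b c d : R) : 'M[R]_2 :=
  \matrix_(i, j) if i == 0 then if j == 0 then a else b
                 else if j == 0 then c else d.

Lemma mx2P (R : Type) (A B : 'M[R]_2) :
  A 0 0 = B 0 0 -> A 0 1 = B 0 1 -> A 1 0 = B 1 0 -> A 1 1 = B 1 1 -> A = B.
Proof.
move=> e00 e01 e10 e11; apply/matrixP => i j.
have ord2 (k : 'I_2) : k = 0 \/ k = 1.
  by case: k => [[|[|//]] ?]; [left | right]; apply: val_inj.
by case: (ord2 i) => ->; case: (ord2 j) => ->.
Qed.

Lemma mx2_in_S (a z c d : 'Z_4) : mx2 a (2 * z) c d \in S_pred.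
Proof. by apply/S_predP; exists z; rewrite mxE. Qed.

(** Storing half of the upper right entry lets all four parameters range freely over ['Z_4]; [z] and
    [z + 2] give the same element. *)
Definition elS (a z c d : 'Z_4) : ringS := RingS (mx2_in_S a z c d).

Definition bottom_row (u : 'Z_4 * 'Z_4) : ringS := elS 0 0 u.1 u.2.

Lemma ringSE (A : ringS) : exists a z c d, A = elS a z c d.
Proof.
have [z Az] := S_predP _ (S_valP A).
exists (S_val A 0 0), z, (S_val A 1 0), (S_val A 1 1).
by apply: val_inj; apply: mx2P; rewrite !mxE.
Qed.

(** The Horner step [v A + u] on row vectors, for [A = ((a, b), (c, d))]. *)
Definition row_step (a b c d : 'Z_4) (u v : 'Z_4 * 'Z_4) : 'Z_4 * 'Z_4 :=
  (v.1 * a + v.2 * c + u.1, v.1 * b + v.2 * d + u.2).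

(** Matrices with zero first row form a right ideal, so Horner's scheme never leaves them and
    evaluation reduces to arithmetic on pairs. *)
Lemma horner_bottom_row (s : seq ('Z_4 * 'Z_4)) (a z c d : 'Z_4) :
  (Poly (map bottom_row s)).[elS a z c d] =
  bottom_row (foldr (row_step a (2 * z) c d) (0, 0) s).
Proof.
rewrite horner_Poly; elim: s => [|u s /= ->].
  by apply: val_inj; apply: mx2P; rewrite !mxE /= ?mulr0.
apply: val_inj; rewrite rmorphD rmorphM /=.
by apply: mx2P; rewrite mxE mulmx2E !mxE /= ?(mulr0, mul0r, addr0).
Qed.

Lemma bottom_row_e11 (u : 'Z_4 * 'Z_4) :
  bottom_row u * elS 1 0 0 0 = bottom_row (u.1, 0).
Proof.
apply: val_inj; rewrite rmorphM /=.
by apply: mx2P; rewrite mulmx2E !mxE /= ?(mulr0, mul0r, addr0, mulr1).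
Qed.

(* The coefficients of [p] and [q], paired, by increasing degree. *)
Definition pq_coefs : seq ('Z_4 * 'Z_4) :=
  [:: (0, 0); (0, 0); (1, 2); (2, 3); (1, 1); (0, 1); (0, 1)].

Lemma pq_row_eq0 (a z c d : 'Z_4) :
  foldr (row_step a (2 * z) c d) (0, 0) pq_coefs == (0, 0).
Proof.
(* Only 256 quadruples remain, all decided by evaluation. *)
move: d; apply: Z4_all; move: c; apply: Z4_all.
move: z; apply: Z4_all; move: a; apply: Z4_all.
by vm_compute.
Qed.

Lemma pq_null : Poly (map bottom_row pq_coefs) \in null_ideal ringS.
Proof.
apply/forallP => A; have [a [z [c [d ->]]]] := ringSE A.
rewrite horner_bottom_row (eqP (pq_row_eq0 a z c d)); apply/eqP.
by apply: val_inj; apply: mx2P; rewrite !mxE /= ?mulr0.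
Qed.

Theorem proposition5p2 : ~ two_sided_ideal (null_ideal ringS).
Proof.
move=> [_ [_ /(_ (elS 1 0 0 0)%:P _ pq_null)]].
rewrite Poly_mulC -map_comp (eq_map bottom_row_e11).
(* The coefficients are again bottom rows, now of [e21 p]. At this point [A^2 = 2], so
   [p(A) = 2 (A + 1)^2 = 2] modulo 4. *)
rewrite (map_comp bottom_row (fun u => (u.1, 0))) => /forallP/(_ (elS 0 1 1 0)).
rewrite horner_bottom_row => /eqP/(congr1 (fun B : ringS => S_val B 1 0)).
by rewrite !mxE => /eqP; vm_compute.
Qed.
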